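(* Let $R=\prod_{i\in\mathcal{A}}R_i/N_iR_i$, where $\mathcal{A}$ is an infinite set, each $R_i$ is a principal ideal domain and $N_i\in R_i$ is not a unit (possibly $N_i=0$). Let $S=R[x_1,\dots,x_n]$ and let $M$ be a finitely generated $S$-module. Suppose $M\cong F/U$, where $F=\bigoplus_{i=1}^rS$ is a finitely generated free $S$-module and $U\subseteq F$ is a submodule such that, for some monomial order on $F$, the $S$-module $\operatorname{LT}(U)$ is finitely generated and $U$ has a Gröbner basis all of whose elements have leading coefficients that are nonzerodivisors in $R$. Then $M$ admits a free $S$-resolution $$0\to F_p\to F_{p-1}\to\dots\to F_1\to F_0\to M\to 0$$ of length $p\le n+1$.
   Context: Let $e_1,\dots,e_r$ be the standard basis of $F$. A monomial of $F$ is an element $ue_i$ with $u$ a monomial of $S$. A monomial order on $F$ is a total order $>$ on the monomials of $F$ such that $wm>m$ for every monomial $m$ of $F$ and every monomial $w\ne1$ of $S$, and such that $m>m'$ implies $wm>wm'$. For $0\neq f\in F$ whose largest monomial is $ue_i$, with coefficient $a\neq 0$, the leading term is $\operatorname{LT}(f)=aue_i$ and the leading coefficient is $\operatorname{lc}(f)=a$. $\operatorname{LT}(U)$ is the $S$-submodule of $F$ generated by the leading terms of the elements of $U$. A finite set $\{f_1,\dots,f_m\}\subseteq U$ is a Gröbner basis of $U$ if $\langle\operatorname{LT}(f_1),\dots,\operatorname{LT}(f_m)\rangle=\operatorname{LT}(U)$. *)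

(* Defs.v *)
From HB Require Import structures.
From mathcomp Require Import all_boot all_algebra.
From mathcomp Require Import boolp classical_sets cardinality functions.
From mathcomp Require Import freeg mpoly.

Set Implicit Arguments.
Unset Strict Implicit.
Unset Printing Implicit Defensive.

Import GRing.Theory.

Local Open Scope ring_scope.
Local Open Scope quotient_scope.
Local Open Scope classical_set_scope.

Definition is_pid (D : idomainType) : Prop :=
  forall I : set D,
    I 0 -> (forall x y, I x -> I y -> I (x + y)) ->
    (forall a x, I x -> I (a * x)) ->
  exists d : D, I = [set a * d | a in [set: D]].

Definition nonzerodivisor (R : comNzRingType) (a : R) : Prop :=
  forall b : R, a * b = 0 -> b = 0.

(* The library's ideals are proper, so the non-unit hypothesis is needed to    *)
(* form the quotient by the ideal N D.                                         *)
Section PrincipalQuotient.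
Variables (D : idomainType) (N : D) (hN : N \isn't a GRing.unit).

Definition principal_ideal of N \isn't a GRing.unit : {pred D} :=
  fun x => `[< exists a : D, x = N * a >].

Fact principal_ideal_closed : idealr_closed (principal_ideal hN).
Proof.
split.
- by apply/asboolP; exists 0; rewrite mulr0.
- apply/negP => /asboolP[a N1]; move/negP: hN; apply.
  by apply/unitrP; exists a; rewrite mulrC -N1.
- move=> a u v /asboolP[b ->] /asboolP[c ->]; apply/asboolP.
  by exists (a * b + c); rewrite mulrDr mulrCA.
Qed.

HB.instance Definition _ :=
  isIdealr.Build D (principal_ideal hN) principal_ideal_closed.

Definition principal_quot : comNzRingType :=
  {ideal_quot (principal_ideal hN : idealr D)}.

End PrincipalQuotient.

(* hA is a phantom parameter of the carrier: the library's commutative rings   *)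
(* are nontrivial, which the empty product is not.                             *)
Section ProductRing.
Variables (A : Type) (B : A -> comNzRingType) (hA : infinite_set [set: A]).

Definition prod_ring of infinite_set [set: A] : Type := forall i, B i.
Local Notation P := (prod_ring hA).

HB.instance Definition _ := Choice.copy P (forall i, B i).

Let zero : P := fun i => 0.
Let opp (f : P) : P := fun i => - f i.
Let add (f g : P) : P := fun i => f i + g i.
Let one : P := fun i => 1.
Let mul (f g : P) : P := fun i => f i * g i.

Let addA : associative add.
Proof. by move=> f g h; apply: functional_extensionality_dep => i; exact: addrA. Qed.
Let addC : commutative add.
Proof. by move=> f g; apply: functional_extensionality_dep => i; exact: addrC. Qed.
Let add0 : left_id zero add.
Proof. by move=> f; apply: functional_extensionality_dep => i; exact: add0r. Qed.
Let addN : left_inverse zero opp add.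
Proof. by move=> f; apply: functional_extensionality_dep => i; exact: addNr. Qed.

HB.instance Definition _ := GRing.isZmodule.Build P addA addC add0 addN.

Let mulA : associative mul.
Proof. by move=> f g h; apply: functional_extensionality_dep => i; exact: mulrA. Qed.
Let mulC : commutative mul.
Proof. by move=> f g; apply: functional_extensionality_dep => i; exact: mulrC. Qed.
Let mul1 : left_id one mul.
Proof. by move=> f; apply: functional_extensionality_dep => i; exact: mul1r. Qed.
Let mulDl : left_distributive mul add.
Proof. by move=> f g h; apply: functional_extensionality_dep => i; exact: mulrDl. Qed.
Let one_neq0 : one != 0.
Proof.
have [i _] := infinite_setN0 hA.
apply/eqP => /(congr1 (fun f : P => f i)) e.
by have /eqP := oner_neq0 (B i); apply.
Qed.

HB.instance Definition _ :=
  GRing.Zmodule_isComNzRing.Build P mulA mulC mul1 mulDl one_neq0.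

End ProductRing.

Definition pid_product (A : Type) (hA : infinite_set [set: A])
    (D : A -> idomainType) (N : forall i, D i)
    (hN : forall i, N i \isn't a GRing.unit) : comNzRingType :=
  prod_ring (fun i => principal_quot (hN i)) hA.

Section QuotientModule.
Variables (S : comNzRingType) (V : lmodType S).

Definition submod_pred (U : submodClosed V) : {pred V} := fun x => x \in U.

Fact submod_pred_zmod (U : submodClosed V) : zmod_closed (submod_pred U).
Proof.
split=> [|x y Ux Uy]; first exact: (rpred0 U).
by rewrite unfold_in -scaleN1r (rpredD (S := U)) // rpredZ.
Qed.

HB.instance Definition _ (U : submodClosed V) :=
  GRing.isZmodClosed.Build V (submod_pred U) (submod_pred_zmod U).

Variable U : submodClosed V.

Definition lmod_quot : Type := Quotient.quot (submod_pred U : zmodClosed V).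

HB.instance Definition _ := GRing.Zmodule.on lmod_quot.
HB.instance Definition _ := Quotient.on lmod_quot.

Let scale (a : S) (x : lmod_quot) : lmod_quot := \pi_lmod_quot (a *: repr x).

Let pi_eqP (x y : V) :
  reflect (\pi_lmod_quot x = \pi_lmod_quot y) (x - y \in U).
Proof.
apply: (iffP idP) => [h|h].
  by apply/eqP; rewrite -(Quotient.idealrBE (submod_pred U : zmodClosed V)).
by move/eqP: h; rewrite -(Quotient.idealrBE (submod_pred U : zmodClosed V)).
Qed.

Let scale_pi a x : scale a (\pi_lmod_quot x) = \pi_lmod_quot (a *: x).
Proof.
apply/pi_eqP; rewrite -scalerBr; apply: rpredZ.
apply/pi_eqP; exact: reprK.
Qed.

Let pi_add x y : \pi_lmod_quot (x + y) = \pi_lmod_quot x + \pi_lmod_quot y.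
Proof. exact: (Quotient.pi_add (submod_pred U : zmodClosed V)). Qed.

Let scaleA a b x : scale a (scale b x) = scale (a * b) x.
Proof. by elim/quotW: x => x; rewrite (scale_pi b x) !scale_pi scalerA. Qed.
Let scale1 : left_id 1 scale.
Proof. by elim/quotW => x; rewrite scale_pi scale1r. Qed.
Let scaleDr : right_distributive scale +%R.
Proof.
move=> a; elim/quotW => x; elim/quotW => y.
by rewrite -pi_add !scale_pi scalerDr pi_add.
Qed.
Let scaleDl x : {morph scale^~ x : a b / a + b}.
Proof.
by elim/quotW: x => x a b; rewrite !scale_pi scalerDl pi_add.
Qed.

HB.instance Definition _ :=
  GRing.Zmodule_isLmodule.Build S lmod_quot scaleA scale1 scaleDr scaleDl.

End QuotientModule.

Section Modules.
Variable S : comNzRingType.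

Definition span (V : lmodType S) (X : set V) : set V :=
  [set v | exists (k : nat) (c : 'I_k -> S) (x : 'I_k -> V),
    (forall j, X (x j)) /\ v = \sum_(j < k) c j *: x j].

Definition finitely_generated (V : lmodType S) (W : set V) : Prop :=
  exists g : seq V, W = span [set` g].

Definition lmod_iso (V W : lmodType S) : Prop :=
  exists f : {linear V -> W}, bijective f.

(* A basis may be infinite. *)
Definition is_basis (V : lmodType S) (B : set V) : Prop :=
  span B = [set: V] /\
  forall (s : seq V) (c : V -> S), uniq s -> [set` s] `<=` B ->
    \sum_(v <- s) c v *: v = 0 -> forall v, v \in s -> c v = 0.

Definition is_free (V : lmodType S) : Prop := exists B : set V, is_basis B.

Definition exact_at (V1 V2 V3 : lmodType S)
    (f : {linear V1 -> V2}) (g : {linear V2 -> V3}) : Prop :=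
  range f = [set x | g x = 0].

(* 0 -> F_p -> ... -> F_0 -> M -> 0 is padded by zero modules in degrees > p.  *)
Definition free_resolution_of_length (M : lmodType S) (p : nat) : Prop :=
  exists (F : nat -> lmodType S) (d : forall j, {linear F j.+1 -> F j})
         (eps : {linear F 0 -> M}),
  [/\ forall j, is_free (F j),
      forall j, (p < j)%N -> forall x : F j, x = 0,
      range eps = [set: M],
      exact_at (d 0) eps
    & forall j, exact_at (d j.+1) (d j)].

End Modules.

(* A monomial u e_i of F = S^r is the pair (u, i), with u given by its         *)
(* exponent vector: the monomial 1 of S is 0%MM and products are sums.         *)
Section Groebner.
Variables (R : comNzRingType) (n r : nat).
Local Notation S := {mpoly R[n]}.
Local Notation F := 'rV[S]_r.

Definition monom : Type := ('X_{1..n} * 'I_r)%type.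
HB.instance Definition _ := Choice.on monom.

Definition mulm (w : 'X_{1..n}) (m : monom) : monom := ((w + m.1)%MM, m.2).

Definition monomial_order (gt : rel monom) : Prop :=
  [/\ irreflexive gt,
      transitive gt,
      forall m m', m != m' -> gt m m' || gt m' m,
      forall (w : 'X_{1..n}) m, w != 0%MM -> gt (mulm w m) m
    & forall (w : 'X_{1..n}) m m', gt m m' -> gt (mulm w m) (mulm w m')].

Definition supp (f : F) : seq monom :=
  [seq (u, i) | i <- enum 'I_r, u <- msupp (f 0 i)].

Definition lead_mon (gt : rel monom) (f : F) : option monom :=
  ohead [seq m <- supp f | all (fun m' => (m' == m) || gt m m') (supp f)].

(* lc(0) = 0 and LT(0) = 0. *)
Definition lc (gt : rel monom) (f : F) : R :=
  if lead_mon gt f is Some m then (f 0 m.2)@_(m.1) else 0.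

Definition LT (gt : rel monom) (f : F) : F :=
  if lead_mon gt f is Some m
  then (lc gt f *: 'X_[m.1]) *: delta_mx 0 m.2 else 0.

Definition LTmod (gt : rel monom) (U : submodClosed F) : set F :=
  span [set LT gt f | f in [set f | f \in U /\ f != 0]].

Definition is_groebner (gt : rel monom) (U : submodClosed F) (G : seq F) : Prop :=
  {subset G <= U} /\ span [set LT gt f | f in [set` G]] = LTmod gt U.

End Groebner.

(* Main.v *)
Require Import Defs.
From HB Require Import structures.
From mathcomp Require Import all_boot all_algebra.
From mathcomp Require Import boolp classical_sets cardinality functions.
From mathcomp Require Import freeg mpoly.

Set Implicit Arguments.
Unset Strict Implicit.
Unset Printing Implicit Defensive.

Import GRing.Theory.

Local Open Scope ring_scope.
Local Open Scope classical_set_scope.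

(** Two facts combine, one about U as an R-module and one about S-modules.

    The submodule U is free over R.  Fix a monomial m.  The coefficients at m of
    the elements of U all of whose monomials are at most m form an ideal of R,
    and the Groebner basis property says that this ideal is generated by the
    leading coefficients of those basis elements whose leading monomial divides
    m.  A product of quotients of principal ideal domains is a Bezout ring, so
    the ideal is generated by one element d_m, and d_m divides a nonzerodivisor
    as soon as some leading monomial divides m; then d_m is a nonzerodivisor as
    well.  Choosing u_m in U with leading term d_m m gives a family that is
    independent over R because it is triangular with nonzerodivisors on the
    diagonal, and that spans U by division: each step lowers the leading
    monomial, and a monomial order is well founded by Dickson's lemma
    ([groebner_free_over_first0]).

    Write R_k for R[x_1, .., x_k].  Let V be an S-module that is free over R_k
    with basis e, where k < n, and let the free S-module on the same basis map
    onto V.  The kernel is free over R_(k+1) ([free_over_first_kernel]).  When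
    n = 1 and k = 0 this is the exact sequence

      0 -> V[x] -> V[x] -> V -> 0

    whose first map is multiplication by x - x_1, where x_1 acts on the
    coefficients.  In general the free module has further basis elements over
    R_(k+1), the products of e with monomials in the later variables; subtracting
    from each of them an element of the R_k-span of e moves it into the kernel.
    Iterating n - k times, an S-module that is free over R_k has a
    free resolution of length n - k, so U has one of length n
    ([free_over_first_resolution]).  Continuing it with U -> F -> M gives length
    n + 1. *)

(** * Free modules, submodules and splicing of resolutions *)

Section FreeModules.
Variables (S : comNzRingType) (I : choiceType) (V : lmodType S) (e : I -> V).

Definition lincomb (g : {freeg I / S}) : V := fglift e g.

HB.instance Definition _ :=
  GRing.isAdditive.Build {freeg I / S} V lincomb (lift_is_additive e).

Lemma lincombU c i : lincomb << c *g i >> = c *: e i.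
Proof. exact: liftU. Qed.

Fact lincomb_is_scalable : scalable lincomb.
Proof.
move=> c g; rewrite -[c *: g]/(fgscale c g) -{2}(freeg_sumE g).
rewrite !(raddf_sum lincomb) scaler_sumr; apply: eq_bigr => i _.
by rewrite /= !lincombU scalerA.
Qed.

HB.instance Definition _ :=
  GRing.isScalable.Build S {freeg I / S} V *:%R lincomb lincomb_is_scalable.

Lemma lincombE g : lincomb g = \sum_(i <- dom g) coeff i g *: e i.
Proof.
rewrite -{1}(freeg_sumE g) linear_sum.
by apply: eq_bigr => i _; rewrite /= lincombU.
Qed.

Lemma is_free_lincomb : bijective lincomb -> is_free V.
Proof.
case=> f fK Kf; exists (range e); split.
  apply/seteqP; split=> // v _; rewrite -[v]Kf lincombE.
  pose t j := tnth (in_tuple (dom (f v))) j.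
  exists (size (dom (f v))), (fun j => coeff (t j) (f v)), (e \o t).
  split=> [j|]; first by exists (t j).
  by rewrite big_tnth.
move=> s c us sB s0 v vs.
have /choice[i ei] : forall w, exists i, w \in s -> e i = w.
  move=> w; have [ws|_] := boolP (w \in s).
    by have [i _ <-] := sB _ ws; exists i.
  by have [i _ _] := sB _ vs; exists i.
have : lincomb (\sum_(w <- s) << c w *g i w >>) = 0.
  rewrite linear_sum -[RHS]s0 [LHS]big_seq [RHS]big_seq.
  by apply: eq_bigr => w ws; rewrite /= lincombU ei.
rewrite -[0 in RHS](linear0 lincomb) => /(can_inj fK)/(congr1 (coeff (i v))).
rewrite coeff0 raddf_sum /= (bigD1_seq v) //= coeffU eqxx mulr1 big_seq_cond.
rewrite big1 ?addr0 // => w /andP[ws wv]; rewrite coeffU.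
case: eqP => [ii|]; last by rewrite mulr0.
by rewrite -(ei w ws) ii ei // eqxx in wv.
Qed.

End FreeModules.

Lemma is_free_freeg (S : comNzRingType) (I : choiceType) :
  is_free {freeg I / S}.
Proof.
apply: (@is_free_lincomb _ I _ (fun i => << i >>)).
exists id => g; rewrite /= lincombE -[RHS]freeg_sumE; apply: eq_bigr => i _;
  by apply/eqP/freeg_eqP => y; rewrite coeffZ !coeffU mul1r.
Qed.

Lemma is_free_rV (S : comNzRingType) r : is_free 'rV[S]_r.
Proof.
apply: (@is_free_lincomb _ 'I_r _ (fun i => delta_mx 0 i)).
have lE (g : {freeg 'I_r / S}) j :
    lincomb (fun i => delta_mx 0 i : 'rV[S]_r) g 0 j = coeff j g.
  rewrite -{1}(freeg_sumE g) linear_sum summxE -[g in RHS]freeg_sumE raddf_sum.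
  apply: eq_bigr => i _; rewrite /= lincombU !mxE /= coeffU.
  by rewrite eq_sym.
exists (fun v : 'rV[S]_r => \sum_i << v 0 i *g i >>) => [g|v].
  apply/eqP/freeg_eqP => j; rewrite raddf_sum (bigD1 j) //= coeffU eqxx mulr1.
  by rewrite big1 ?addr0 ?lE // => i ij; rewrite coeffU (negPf ij) mulr0.
apply/rowP => j; rewrite lE raddf_sum (bigD1 j) //= coeffU eqxx mulr1.
by rewrite big1 ?addr0 // => i ij; rewrite coeffU (negPf ij) mulr0.
Qed.

Section Submodules.
Variables (S : comNzRingType) (V : lmodType S).

Record submodule (U : submodClosed V) :=
  Submodule { submodule_val : V; _ : submodule_val \in U }.

HB.instance Definition _ (U : submodClosed V) :=
  [isSub for @submodule_val U].
HB.instance Definition _ (U : submodClosed V) :=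
  [Choice of submodule U by <:].
HB.instance Definition _ (U : submodClosed V) :=
  [SubChoice_isSubLmodule of submodule U by <:].

Definition submodule_incl (U : submodClosed V) : {linear submodule U -> V} :=
  val.

Lemma submodule_incl_inj (U : submodClosed V) : injective (submodule_incl U).
Proof. exact: val_inj. Qed.

Lemma range_submodule_incl (U : submodClosed V) :
  range (submodule_incl U) = [set x | x \in U].
Proof.
apply/seteqP; split=> [_ [[x Ux] _ <-] //|x Ux].
by exists (Submodule Ux).
Qed.

Variables (W : lmodType S) (f : {linear V -> W}).

Definition kernel : {pred V} := fun x => f x == 0.

Fact kernel_closed : submod_closed kernel.
Proof.
split; first by rewrite unfold_in linear0.
by move=> a x y /eqP fx /eqP fy; rewrite unfold_in linearP fx fy scaler0 addr0.
Qed.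

HB.instance Definition _ :=
  GRing.isSubmodClosed.Build S V kernel kernel_closed.

End Submodules.

Section Resolutions.
Variable S : comNzRingType.

Lemma free_resolution_free (V : lmodType S) :
  is_free V -> free_resolution_of_length V 0.
Proof.
move=> Vfree.
pose F j : lmodType S := if j is 0 then V else 'rV[S]_0.
have F0 j (x : F j.+1) : x = 0 by apply/rowP; case.
exists F, (fun=> \0), idfun; split.
- by case=> [|j] //; apply: is_free_rV.
- by case.
- by apply/seteqP; split=> // x _; exists x.
- by apply/seteqP; split=> [_ [x _ <-] //|x /= ->]; exists 0.
- move=> j; apply/seteqP; split=> [_ [x _ <-] //|x _]; exists 0 => //.
  by rewrite [x]F0.
Qed.

(** Stated for any injection onto the kernel of [q], so that it serves both for
    the kernels that arise in the iteration and for the submodule [U] itself. *)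
Lemma free_resolution_splice (K G V : lmodType S) (i : {linear K -> G})
    (q : {linear G -> V}) p :
    injective i -> is_free G -> range q = [set: V] -> exact_at i q ->
  free_resolution_of_length K p -> free_resolution_of_length V p.+1.
Proof.
move=> i_inj Gfree q_onto iq [F [d [eps [Ffree F0 eps_onto eps_d dd]]]].
pose F' j : lmodType S := if j is j'.+1 then F j' else G.
pose d' j : {linear F' j.+1 -> F' j} :=
  match j with 0 => (i \o eps)%FUN | j'.+1 => d j' end.
exists F', d', q; split.
- by case.
- by case=> // j; apply: F0.
- exact: q_onto.
- rewrite /exact_at -iq; apply/seteqP; split=> [_ [x _ <-]|_ [y _ <-]] /=.
    by exists (eps x).
  have [x _ <-] : range eps y by rewrite eps_onto.
  by exists x.
- case=> [|j] /=; last exact: dd.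
  rewrite /exact_at eps_d; apply/seteqP; split=> x /= => [->|ix0].
    by rewrite linear0.
  by apply: i_inj; rewrite ix0 linear0.
Qed.

End Resolutions.

(** * Degree in the variables of index at least k *)

Section TailDegree.
Variable n : nat.
Implicit Types (k : nat) (u v m : 'X_{1..n}).

Definition tail_deg k u : nat := \sum_(j < n | (k <= j)%N) u j.

Lemma tail_deg_mul k u v : tail_deg k (u + v) = (tail_deg k u + tail_deg k v)%N.
Proof.
by rewrite -big_split; apply: eq_bigr => j _; rewrite mnmDE.
Qed.

Lemma tail_deg_eq0P k u :
  reflect (forall j : 'I_n, (k <= j)%N -> u j = 0%N) (tail_deg k u == 0%N).
Proof.
rewrite sum_nat_eq0; apply: (iffP forall_inP) => h j kj; last by rewrite h.
by apply/eqP/h.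
Qed.

(** Each monomial that involves variables beyond the first [k] is uniquely the
    product of a monomial in the first [k.+1] variables and one of these. They
    therefore index the basis over the first [k.+1] variables of the kernel
    constructed below: [U_(k)] stands for multiplication by x - x_k, the others
    for the basis monomials of the free module that get corrected into the
    kernel. *)
Definition step_gen (k : 'I_n) m : bool :=
  (m == U_(k)%MM) ||
  ((m != 0%MM) && [forall j : 'I_n, (j <= k)%N ==> (m j == 0%N)]).

Lemma tail_deg_step_gen (k : 'I_n) m : step_gen k m -> (0 < tail_deg k m)%N.
Proof.
rewrite lt0n => gen_m; apply/tail_deg_eq0P => m0.
case/orP: gen_m => [/eqP mk|/andP[/eqP + /'forall_implyP mle]].
  by have := m0 k (leqnn k); rewrite mk mnm1E eqxx.
apply; apply/mnmP => j; rewrite mnm0E.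
by have [/mle/eqP|/ltnW/m0] := leqP j k.
Qed.

Lemma step_gen_split (k : 'I_n) u : tail_deg k u != 0%N ->
  exists a m, [/\ u = (a + m)%MM, step_gen k m & tail_deg k.+1 a = 0%N].
Proof.
move=> u_tail; have [u0|u_tail'] := eqVneq (tail_deg k.+1 u) 0%N.
  have uk : (0 < u k)%N.
    rewrite lt0n; apply: contra u_tail => /eqP uk; apply/tail_deg_eq0P => j.
    rewrite leq_eqVlt => /orP[/eqP/val_inj <- //|].
    by move/eqP/tail_deg_eq0P: u0; apply.
  have le_u : (U_(k) <= u)%MM.
    by apply/mnm_lepP => j; rewrite mnm1E; case: eqP => // <-.
  exists (u - U_(k))%MM, U_(k)%MM; split; first by rewrite submK.
    by rewrite /step_gen eqxx.
  apply/eqP; rewrite -leqn0 -[X in (_ <= X)%N]u0.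
  by rewrite -{2}(submK le_u) tail_deg_mul leq_addr.
exists [multinom if (j <= k)%N then u j else 0%N | j < n].
exists [multinom if (j <= k)%N then 0%N else u j | j < n]; split.
- apply/mnmP => j; rewrite mnmDE !mnmE.
  by case: ifP; rewrite ?addn0.
- apply/orP; right; apply/andP; split.
    apply: contra u_tail' => /eqP m0; apply/tail_deg_eq0P => j kj.
    by move/mnmP: m0 => /(_ j); rewrite mnmE mnm0E leqNgt kj.
  by apply/'forall_implyP => j jk; rewrite mnmE jk.
- by apply/eqP/tail_deg_eq0P => j kj; rewrite mnmE leqNgt kj.
Qed.

Lemma step_gen_inj (k : 'I_n) a a' m m' :
    tail_deg k.+1 a = 0%N -> tail_deg k.+1 a' = 0%N ->
    step_gen k m -> step_gen k m' -> (a + m = a' + m')%MM -> m = m'.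
Proof.
move=> /eqP/tail_deg_eq0P a0 /eqP/tail_deg_eq0P a'0 gm gm' /mnmP e.
have tail (j : 'I_n) : (k < j)%N -> m j = m' j.
  by move=> kj; have := e j; rewrite !mnmDE a0 ?a'0.
have no_mix (x y : 'X_{1..n}) : (forall j : 'I_n, (k < j)%N -> x j = y j) ->
    x = U_(k)%MM -> y != 0%MM -> ~ forall j : 'I_n, (j <= k)%N -> y j = 0%N.
  move=> xy xk /eqP y0 yle; apply: y0; apply/mnmP => j; rewrite mnm0E.
  have [/yle //|kj] := leqP j k; rewrite -xy // xk mnm1E.
  by case: eqP kj => // ->; rewrite ltnn.
case/orP: gm => [/eqP mk|/andP[m0 /'forall_implyP mle]];
  case/orP: gm' => [/eqP mk'|/andP[m0' /'forall_implyP mle']].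
- by rewrite mk mk'.
- by case: (no_mix m m') => // j /mle'/eqP.
- by case: (no_mix m' m) => // j => [/tail -> //|/mle/eqP].
- apply/mnmP => j; have [jk|/tail //] := leqP j k.
  by rewrite (eqP (mle j jk)) (eqP (mle' j jk)).
Qed.

End TailDegree.

Section TailBounded.
Variables (R : comNzRingType) (n : nat) (I : choiceType).
Local Notation S := {mpoly R[n]}.
Local Notation G := {freeg I / S}.
Implicit Types (g h : G) (k d : nat).

(** For [d] equal to 0 this says that the coefficients of [g] involve the first
    [k] variables only. *)
Definition tail_le k d g : Prop :=
  forall i u, u \in msupp (coeff i g) -> (tail_deg k u <= d)%N.

Lemma tail_le0 k d : tail_le k d 0.
Proof. by move=> i u; rewrite coeff0 msupp0. Qed.

Lemma tail_leD k d g h : tail_le k d g -> tail_le k d h -> tail_le k d (g + h).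
Proof.
move=> hg hh i u; rewrite coeffD => /msuppD_le; rewrite mem_cat.
by case/orP; [apply: hg|apply: hh].
Qed.

Lemma tail_leZ k d d' (p : S) g :
    (forall u, u \in msupp p -> (tail_deg k u <= d')%N) ->
  tail_le k d g -> tail_le k (d' + d) (p *: g).
Proof.
move=> hp hg i u; rewrite coeffZ => /msuppM_le/allpairsP[[a b] [/= pa gb ->]].
by rewrite tail_deg_mul leq_add ?hp ?(hg i).
Qed.

Lemma tail_leW k d d' g : (d <= d')%N -> tail_le k d g -> tail_le k d' g.
Proof. by move=> dd' hg i u /hg ud; apply: leq_trans dd'. Qed.

Lemma tail_leU k d (p : S) i :
    (forall u, u \in msupp p -> (tail_deg k u <= d)%N) ->
  tail_le k d << p *g i >>.
Proof.
move=> hp j u; rewrite coeffU; case: eqP => _ ; last by rewrite mulr0 msupp0.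
by rewrite mulr1; apply: hp.
Qed.

Lemma freeg_monomial_ind (P : G -> Prop) g :
    P 0 -> (forall g h, P g -> P h -> P (g + h)) ->
    (forall c u i, u \in msupp (coeff i g) -> P << c *: 'X_[u] *g i >>) ->
  P g.
Proof.
move=> P0 PD PX; rewrite -[g]freeg_sumE.
elim/big_ind: _ => // i _.
have -> : << coeff i g *g i >> =
    \sum_(u <- msupp (coeff i g)) << (coeff i g)@_u *: 'X_[u] *g i >> :> G.
  apply/eqP/freeg_eqP => j.
  rewrite raddf_sum coeffU {1}[coeff i g]mpolyE mulr_suml.
  by apply: eq_bigr => u _; rewrite /= coeffU.
by rewrite big_seq; elim/big_ind: _ => // u /PX.
Qed.

Lemma tail_le00_coeff h i :
  tail_le 0 0 h -> coeff i h = ((coeff i h)@_0%MM)%:MP.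
Proof.
move=> h_tail; apply/mpolyP => w; rewrite mcoeffC.
have [->|w0] := eqVneq w 0%MM; first by rewrite mulr1.
rewrite mulr0 memN_msupp_eq0 //; apply: contra w0 => /h_tail.
rewrite leqn0 => /tail_deg_eq0P w0; apply/eqP/mnmP => j.
by rewrite mnm0E w0.
Qed.

End TailBounded.

(** Freeness over the subring of polynomials in the first [k] variables, said
    without restricting scalars: every element is a unique combination of the
    family with coefficients in that subring. For [k] equal to 0 the subring
    is the ring of constants, for [k] equal to [n] it is everything. *)
Definition free_over_first (R : comNzRingType) n k
    (V : lmodType {mpoly R[n]}) : Prop :=
  exists (I : choiceType) (e : I -> V),
    (forall v, exists2 g, tail_le k 0 g & lincomb e g = v) /\
    (forall g, tail_le k 0 g -> lincomb e g = 0 -> g = 0).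

Lemma seq_argmax (T : eqType) (f : T -> nat) (s : seq T) :
  s != [::] -> exists2 x, x \in s & forall y, y \in s -> (f y <= f x)%N.
Proof.
elim: s => [//|x s IH] _; have [->|/IH[y ys ymax]] := eqVneq s [::].
  by exists x; rewrite ?mem_head // => y; rewrite inE => /eqP ->.
have [xy|yx] := leqP (f x) (f y).
  exists y; first by rewrite inE ys orbT.
  by move=> z; rewrite inE => /orP[/eqP -> //|/ymax].
exists x; first by rewrite mem_head.
move=> z; rewrite inE => /orP[/eqP -> //|/ymax zy].
exact: leq_trans zy (ltnW yx).
Qed.

Lemma linear_lincomb (S : comNzRingType) (I : choiceType) (V W : lmodType S)
    (f : {linear V -> W}) (e : I -> V) g :
  f (lincomb e g) = lincomb (f \o e) g.
Proof.
by rewrite !lincombE linear_sum; apply: eq_bigr => i _; rewrite linearZ.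
Qed.

(** * Passing to the kernel frees one more variable *)

Section Step.
Variables (R : comNzRingType) (n : nat) (k : 'I_n).
Local Notation S := {mpoly R[n]}.
Variables (V : lmodType S) (I : choiceType) (e : I -> V).
Local Notation G := {freeg I / S}.
Hypothesis e_free : forall g, tail_le k 0 g -> lincomb e g = 0 -> g = 0.
Variable s : V -> G.
Hypothesis s_tail : forall v, tail_le k 0 (s v).
Hypothesis sK : cancel s (lincomb e).

Definition step_index : choiceType :=
  {p : ('X_{1..n} * I)%type | step_gen k p.1}.

(** The monomial multiples of the basis of the free module, corrected into the
    kernel by the section [s]. The values of [s] have tail degree 0, so the
    second term has smaller tail degree than the first; all arguments below
    rest on this triangularity. *)
Definition step_rel (p : 'X_{1..n} * I) : G :=
  << 'X_[p.1] *g p.2 >> - s ('X_[p.1] *: e p.2).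

Definition step_family (p : step_index) : G := step_rel (val p).

Lemma lincomb_step_rel p : lincomb e (step_rel p) = 0.
Proof. by rewrite /step_rel linearB /= lincombU sK subrr. Qed.

(** Modulo the relations every element reduces to one with coefficients in the
    first [k] variables: a monomial [u] of positive tail degree splits as [a]
    times a generator [m], and subtracting [a] times the relation of [m]
    replaces it by monomials of the smaller tail degree of [a]. *)
Lemma step_reduce d g : tail_le k d g ->
  exists2 h, tail_le k.+1 0 h & tail_le k 0 (g - lincomb step_family h).
Proof.
elim: d g => [|d IH] g g_tail.
  by exists 0; [apply: tail_le0 | rewrite linear0 subr0].
apply: (freeg_monomial_ind (P := fun g => exists2 h, tail_le k.+1 0 h &
  tail_le k 0 (g - lincomb step_family h)))
  => [|g1 g2 [h1 h1t r1] [h2 h2t r2]|c u i ug].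
- by exists 0; [apply: tail_le0 | rewrite linear0 subr0; apply: tail_le0].
- exists (h1 + h2); first exact: tail_leD.
  by rewrite linearD opprD addrACA; apply: tail_leD.
have [u0|/step_gen_split[a [m [eu gen_m a0]]]] := eqVneq (tail_deg k u) 0%N.
  exists 0; first exact: tail_le0.
  rewrite linear0 subr0; apply: tail_leU => w /msuppZ_le.
  by rewrite msuppX inE => /eqP ->; rewrite u0.
pose h1 : {freeg step_index / S} := << c *: 'X_[a] *g exist _ (m, i) gen_m >>.
have h1_tail : tail_le k.+1 0 h1.
  apply: tail_leU => w /msuppZ_le; rewrite msuppX inE => /eqP ->.
  by rewrite a0.
have rem : << c *: 'X_[u] *g i >> - lincomb step_family h1 =
    (c *: 'X_[a]) *: s ('X_[m] *: e i).
  rewrite lincombU /step_family /step_rel /= scalerBr opprB addrCA.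
  have -> : (c *: 'X_[a]) *: << 'X_[m] *g i >> = << c *: 'X_[u] *g i >> :> G.
    apply/eqP/freeg_eqP => j; rewrite coeffZ !coeffU mulrA eu mpolyXD.
    by rewrite -scalerAl.
  by rewrite subrr addr0.
have /IH[h2 h2_tail r2] : tail_le k d (<< c *: 'X_[u] *g i >> -
    lincomb step_family h1).
  rewrite rem; apply: (@tail_leW _ _ _ _ (tail_deg k a + 0)).
    have := g_tail _ _ ug; rewrite eu tail_deg_mul addn0 => le_d.
    rewrite -ltnS; apply: leq_trans le_d.
    by rewrite -addn1 leq_add2l tail_deg_step_gen.
  apply: tail_leZ => [w /msuppZ_le|]; last exact: s_tail.
  by rewrite msuppX inE => /eqP ->.
exists (h1 + h2); first exact: tail_leD.
by rewrite linearD opprD addrA.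
Qed.

Lemma step_family_span g : lincomb e g = 0 ->
  exists2 h, tail_le k.+1 0 h & lincomb step_family h = g.
Proof.
move=> eg0.
have [d g_tail] : exists d, tail_le k d g.
  exists (\max_(i <- dom g) \max_(u <- msupp (coeff i g)) tail_deg k u).
  move=> i u ug; have ig : i \in dom g.
    by rewrite mem_dom; apply: contraTneq ug => ->; rewrite msupp0.
  by apply: leq_trans (leq_bigmax_seq _ ig isT); apply: leq_bigmax_seq.
have [h h_tail /e_free r0] := step_reduce g_tail.
exists h => //; apply/eqP; rewrite eq_sym -subr_eq0 r0 //.
rewrite linearB /= eg0 (linear_lincomb (lincomb e)) lincombE.
rewrite big1 ?subr0 // => p _.
by rewrite /= /step_family lincomb_step_rel scaler0.
Qed.

(** In a vanishing combination pick a coefficient monomial [a] of a relation [p]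
    for which the product of [a] with the generator of [p] has maximal tail
    degree. At that product the correction terms contribute nothing, since their
    tail degree is too small, and the other relations contribute nothing by
    uniqueness of the splitting; so the coefficient of [a] vanishes. *)
Lemma step_family_free h :
  tail_le k.+1 0 h -> lincomb step_family h = 0 -> h = 0.
Proof.
move=> h_tail h0; apply/eqP; apply: contraT => h_neq0; apply/negP=> _.
pose L := [seq (p, a) | p <- dom h, a <- msupp (coeff p h)].
have L_neq0 : L != [::].
  move: h_neq0; rewrite -dom_eq0 /L.
  case: (dom h) (mem_dom h) => // p s' /(_ p); rewrite mem_head => /esym.
  by rewrite -msupp_eq0 /=; case: (msupp _).
have [[p a] /allpairsPdep[p' [a' [ph ah [ep ea]]]] max_pa] :=
  seq_argmax (fun q => tail_deg k q.2 + tail_deg k (val q.1).1)%N L_neq0.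
move: ep ea ph ah => <- <- ph ah {p' a'}.
have inL q b : b \in msupp (coeff q h) -> (q, b) \in L.
  move=> bh; apply/allpairsPdep; exists q, b; split=> //.
  by rewrite mem_dom -msupp_eq0; case: (msupp _) bh.
have a0 q b : b \in msupp (coeff q h) -> tail_deg k.+1 b = 0%N.
  by move=> /h_tail; rewrite leqn0 => /eqP.
have := congr1 (fun g => (coeff (val p).2 g)@_((val p).1 + a)%MM) h0.
rewrite coeff0 mcoeff0 lincombE !raddf_sum /=.
have termE q : (coeff (val p).2 (coeff q h *: step_family q))@_((val p).1 + a) =
    (coeff q h)@_a *+ (q == p).
  rewrite coeffZ /step_family /step_rel coeffB coeffU mulrBr mcoeffB.
  rewrite [X in _ - X]memN_msupp_eq0 ?subr0; last first.
    apply/negP => /msuppM_le/allpairsP[[b c] [/= bh cs ebc]].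
    have c0 : tail_deg k c = 0%N.
      by apply/eqP; rewrite -leqn0 (s_tail cs).
    have := max_pa _ (inL _ _ bh); rewrite /= [X in (_ <= X)%N]addnC.
    rewrite -[X in (_ <= X)%N]tail_deg_mul [(_ + a)%MM]ebc.
    rewrite tail_deg_mul c0 leq_add2l leqNgt.
    by rewrite (tail_deg_step_gen (valP q)).
  have [->|qp] := eqVneq q p; first by rewrite eqxx mulr1 mcoeffMX.
  rewrite mulrb; have [e2|_] := eqVneq; last by rewrite !mulr0 mcoeff0.
  rewrite mulr1 memN_msupp_eq0 //; apply/negP.
  move=> /msuppM_le/allpairsP[[b c] [/= bh + ebc]].
  rewrite msuppX inE => /eqP ec; rewrite {c}ec in ebc.
  case/eqP: qp; apply/val_inj; rewrite [val q]surjective_pairing e2.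
  rewrite [RHS]surjective_pairing; congr (_, _).
  apply: (@step_gen_inj _ k b a);
    rewrite ?(a0 _ _ bh) ?(a0 _ _ ah) ?(valP q) //.
    exact: (valP p).
  by rewrite -ebc addmC.
rewrite (eq_bigr _ (fun q _ => termE q)) (bigD1_seq p) ?uniq_dom //= eqxx.
rewrite big1 ?addr0 => [|q /negPf -> //].
by move/eqP; apply/negP; rewrite -mcoeff_msupp.
Qed.

End Step.

Lemma free_over_first_kernel (R : comNzRingType) n (k : 'I_n)
    (V : lmodType {mpoly R[n]}) : free_over_first k V ->
  exists (G K : lmodType {mpoly R[n]}) (i : {linear K -> G})
         (q : {linear G -> V}),
    [/\ is_free G, injective i, range q = [set: V], exact_at i q
      & free_over_first k.+1 K].
Proof.
case=> I [e [e_span e_free]].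
have /choice[s sP] v : exists g, tail_le k 0 g /\ lincomb e g = v.
  by have [g] := e_span v; exists g.
have s_tail v := (sP v).1.
have sK : cancel s (lincomb e) := fun v => (sP v).2.
pose q : {linear {freeg I / {mpoly R[n]}} -> V} := lincomb e.
pose U : submodClosed _ := kernel q.
exists {freeg I / {mpoly R[n]}}, (submodule U), (submodule_incl U), q; split.
- exact: is_free_freeg.
- exact: submodule_incl_inj.
- by apply/seteqP; split=> // v _; exists (s v) => //; apply: sK.
- rewrite /exact_at range_submodule_incl; apply/seteqP.
  by split=> g /=; rewrite unfold_in => /eqP.
have U_rel p : step_rel e s p \in U.
  by rewrite unfold_in; apply/eqP/lincomb_step_rel.
pose e' (p : step_index k I) : submodule U := Submodule (U_rel (val p)).
have val_e' h : val (lincomb e' h) = lincomb (step_family e s) h.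
  exact: (linear_lincomb (submodule_incl U)).
exists (step_index k I), e'; split=> [v|h h_tail h0].
  have /eqP/(step_family_span e_free s_tail sK)[h h_tail hv] := valP v.
  by exists h => //; apply: val_inj; rewrite val_e'.
apply: (step_family_free (s := s) (e := e) s_tail h_tail).
by rewrite -[LHS]val_e' h0.
Qed.

(** Each step spends one of the [d] remaining variables; once the module is free
    over all of them, it is its own resolution. *)
Lemma free_over_first_resolution (R : comNzRingType) n k d
    (V : lmodType {mpoly R[n]}) :
  (k + d)%N = n -> free_over_first k V -> free_resolution_of_length V d.
Proof.
elim: d k V => [|d IH] k V ekd.
  case=> I [e [e_span e_free]]; apply: free_resolution_free.
  have all_tail g : tail_le k 0 (g : {freeg I / {mpoly R[n]}}).
    move=> i u _; rewrite leqn0; apply/tail_deg_eq0P => j.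
    by have := ltn_ord j; rewrite -{2}ekd addn0 ltnNge => /negPf ->.
  have /choice[s sP] v : exists g, lincomb e g = v.
    by have [g _] := e_span v; exists g.
  apply: (is_free_lincomb (e := e)); exists s => // g.
  apply/eqP; rewrite -subr_eq0; apply/eqP/e_free => //.
  by rewrite linearB /= sP subrr.
have kn : (k < n)%N by rewrite -ekd -addSnnS leq_addr.
move=> /(@free_over_first_kernel _ _ (Ordinal kn)).
case=> G [K [i [q [Gfree i_inj q_onto iq Kfree]]]].
apply: (free_resolution_splice i_inj Gfree q_onto iq).
by apply: IH Kfree; rewrite addSnnS.
Qed.

(** * Monomial orders are well founded *)

Lemma nondecreasing_subsequence (a : nat -> nat) :
  exists phi : nat -> nat, {homo phi : i j / (i < j)%N} /\
    {homo a \o phi : i j / (i <= j)%N}.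
Proof.
(* [g N] is the position of a minimum of [a] beyond [N]. *)
have /choice[g gP] N : exists j, (N <= j)%N /\
    forall j', (N <= j')%N -> (a j <= a j')%N.
  pose P v := `[< exists2 j, (N <= j)%N & a j = v >].
  have exP : exists v, P v by exists (a N); apply/asboolP; exists N.
  case: (ex_minnP exP) => v /asboolP[j Nj <-] vmin.
  by exists j; split=> // j' Nj'; apply: vmin; apply/asboolP; exists j'.
pose phi := fix phi k := if k is k'.+1 then g (phi k').+1 else g 0%N.
have phi_lt k : (phi k < phi k.+1)%N by rewrite /= (gP _).1.
exists phi; split; first exact: (homo_ltn ltn_trans).
apply: (homo_leq leqnn leq_trans) => k /=.
have [N ->] : exists N, phi k = g N by case: k => [|k]; eexists.
by apply: (gP N).2; apply: leq_trans (gP N).1 _; apply/ltnW/(gP _).1.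
Qed.

Lemma dickson (T : finType) (f : nat -> T -> nat) :
  exists i j, (i < j)%N /\ forall t, (f i t <= f j t)%N.
Proof.
suff [phi [phi_lt phiP]] : exists phi : nat -> nat,
    {homo phi : i j / (i < j)%N} /\
    forall t, t \in enum T -> {homo f^~ t \o phi : i j / (i <= j)%N}.
  exists (phi 0%N), (phi 1%N); split=> [|t]; first exact: phi_lt.
  by apply: (phiP t _ 0%N 1%N); rewrite ?mem_enum.
elim: (enum T) => [|t s [phi [phi_lt phiP]]].
  by exists id; split=> // i j.
have [psi [psi_lt psiP]] := nondecreasing_subsequence (f^~ t \o phi).
exists (phi \o psi); split=> [i j ij|t']; first exact/phi_lt/psi_lt.
rewrite inE => /orP[/eqP ->|/phiP t's]; first exact: psiP.
by move=> i j /(ltnW_homo psi_lt)/t's.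
Qed.

Lemma wf_of_no_descending_chain (T : Type) (lt : T -> T -> Prop) :
  (forall c : nat -> T, ~ forall k, lt (c k.+1) (c k)) -> well_founded lt.
Proof.
move=> no_chain; apply: contrapT => /existsNP[x0 x0N].
have /choice[f fP] (x : {x | ~ Acc lt x}) :
    exists y : {x | ~ Acc lt x}, lt (sval y) (sval x).
  case: x => x xN /=; apply: contrapT => noy; apply: (xN); constructor=> y yx.
  by apply: contrapT => yN; apply: noy; exists (exist _ y yN).
pose c k := sval (iter k f (exist _ x0 x0N)).
by apply: (no_chain c) => k; apply: fP.
Qed.

Section MonomialOrder.
Variables (n r : nat) (gt : rel (monom n r)).
Hypothesis gt_order : monomial_order gt.

(** In a descending chain Dickson's lemma finds an earlier monomial that divides
    a later one, although multiples are larger. *)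
Lemma monomial_order_wf : well_founded (fun m m' : monom n r => gt m' m).
Proof.
case: gt_order => irr tr _ gt_mul _.
apply: wf_of_no_descending_chain => c c_desc.
(* The component is recorded by its index and by the complement of its index,
   so that comparing both coordinates forces equal components. *)
pose f k (t : 'I_n + bool) : nat :=
  match t with
  | inl j => (c k).1 j
  | inr b => if b then (c k).2 : nat else (r - (c k).2)%N
  end.
have [i [j [ij le_f]]] := dickson f.
have c_gt : gt (c i) (c j).
  by apply: (homo_ltn (r := gt) (fun y x z => @tr y x z)) ij.
have e2 : (c i).2 = (c j).2.
  apply/val_inj/eqP; rewrite eqn_leq (le_f (inr true)) /=.
  have := le_f (inr false); rewrite /= leq_sub2lE //.
  exact/ltnW/ltn_ord.
have le1 : ((c i).1 <= (c j).1)%MM.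
  by apply/mnm_lepP => t; apply: (le_f (inl t)).
have ecj : c j = mulm ((c j).1 - (c i).1) (c i).
  by rewrite /mulm submK // e2 -surjective_pairing.
move: c_gt; rewrite ecj; have [->|w0] := eqVneq ((c j).1 - (c i).1)%MM 0%MM.
  by rewrite /mulm add0m -surjective_pairing irr.
by move=> /(tr _ _ _ (gt_mul _ (c i) w0)); rewrite irr.
Qed.

Lemma seq_max (T : eqType) (mon : T -> monom n r) (s : seq T) : s != [::] ->
  exists2 x, x \in s & forall y, y \in s -> mon y = mon x \/ gt (mon x) (mon y).
Proof.
case: gt_order => irr tr tot _ _.
elim: s => [//|x s IH] _; have [->|/IH[y ys ymax]] := eqVneq s [::].
  by exists x; rewrite ?mem_head // => y; rewrite inE => /eqP ->; left.
have [e|ne] := eqVneq (mon x) (mon y).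
  exists y; first by rewrite inE ys orbT.
  by move=> z; rewrite inE => /orP[/eqP ->|/ymax //]; left.
have /orP[xy|yx] := tot _ _ ne.
  exists x; first exact: mem_head.
  move=> z; rewrite inE => /orP[/eqP ->|/ymax[->|yz]]; [by left|by right|].
  by right; apply: tr xy yz.
exists y; first by rewrite inE ys orbT.
by move=> z; rewrite inE => /orP[/eqP ->|/ymax]; first right.
Qed.

End MonomialOrder.

(** * Bezout rings *)

Definition is_bezout (R : comNzRingType) : Prop :=
  forall a b : R, exists d u v a' b',
    [/\ d = u * a + v * b, a = a' * d & b = b' * d].

(** The gcd is sought inside an ideal [J] rather than as an explicit
    combination: the gcd of leading coefficients has to be again the leading
    coefficient of an element of the submodule. *)
Lemma bezout_gcd (R : comNzRingType) (J : set R) (s : seq R) :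
    is_bezout R -> J 0 -> (forall a x y, J x -> J y -> J (a * x + y)) ->
    (forall x, x \in s -> J x) ->
  exists2 d, J d & forall x, x \in s -> exists q, x = q * d.
Proof.
move=> bezR J0 JP; elim: s => [|x s IH] sJ; first by exists 0.
have [y ys|d Jd ds] := IH; first by apply: sJ; rewrite inE ys orbT.
have [d' [u [v [a [b [ed ea eb]]]]]] := bezR x d.
exists d'.
  rewrite ed -[v * d]addr0; apply: (JP); last exact: JP.
  by apply: sJ; apply: mem_head.
move=> y; rewrite inE => /orP[/eqP ->|/ds[q ->]]; first by exists a.
by exists (q * b); rewrite -mulrA -eb.
Qed.

Local Open Scope quotient_scope.

Lemma principal_quot_bezout (D : idomainType) (N : D)
    (hN : N \isn't a GRing.unit) : is_pid D -> is_bezout (principal_quot hN).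
Proof.
move=> pidD x y.
pose piQ : D -> principal_quot hN := \pi_(principal_quot hN).
have piM a b : piQ (a * b) = piQ a * piQ b by exact: rmorphM.
have piD a b : piQ (a + b) = piQ a + piQ b by exact: rmorphD.
have [|a b [u1 [v1 ->]] [u2 [v2 ->]]|a b [u [v ->]]|d Id] := pidD
  [set c | exists u v, c = u * repr x + v * repr y].
- by exists 0, 0; rewrite !mul0r addr0.
- by exists (u1 + u2), (v1 + v2); rewrite !mulrDl addrACA.
- by exists (a * u), (a * v); rewrite mulrDr !mulrA.
have [u [v ed]] : [set c | exists u v, c = u * repr x + v * repr y] d.
  by rewrite Id; exists 1 => //; rewrite mul1r.
have [a _ ea] : [set a * d | a in [set: D]] (repr x).
  by rewrite -Id; exists 1, 0; rewrite mul1r mul0r addr0.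
have [b _ eb] : [set a * d | a in [set: D]] (repr y).
  by rewrite -Id; exists 0, 1; rewrite mul1r mul0r add0r.
exists (piQ d), (piQ u), (piQ v), (piQ a), (piQ b).
have piK z : piQ (repr z) = z by exact: reprK.
split; first by rewrite ed piD !piM !piK.
  by rewrite -piM ea piK.
by rewrite -piM eb piK.
Qed.

Lemma prod_ring_bezout (A : Type) (B : A -> comNzRingType)
    (hA : infinite_set [set: A]) :
  (forall i, is_bezout (B i)) -> is_bezout (prod_ring B hA).
Proof.
move=> bezB a b.
have bezP i : exists t : B i * B i * B i * (B i * B i),
    [/\ t.1.1.1 = t.1.1.2 * a i + t.1.2 * b i, a i = t.2.1 * t.1.1.1
      & b i = t.2.2 * t.1.1.1].
  have [d [u [v [a' [b' e]]]]] := bezB i (a i) (b i).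
  by exists (d, u, v, (a', b')).
pose t i := sval (cid (bezP i)).
exists (fun i => (t i).1.1.1), (fun i => (t i).1.1.2), (fun i => (t i).1.2).
exists (fun i => (t i).2.1), (fun i => (t i).2.2).
by split; apply: functional_extensionality_dep => i;
  case: (svalP (cid (bezP i))).
Qed.

(** * A basis over R of a submodule with a Groebner basis *)

Section GroebnerFree.
Variables (R : comNzRingType) (n r : nat) (gt : rel (monom n r)).
Local Notation S := {mpoly R[n]}.
Local Notation F := 'rV[S]_r.
Hypothesis gt_order : monomial_order gt.
Implicit Types (f g : F) (m : monom n r).

Definition mono_coeff m f : R := (f 0 m.2)@_(m.1).

Fact mono_coeff_is_additive m : additive (mono_coeff m).
Proof. by move=> f g; rewrite /mono_coeff !mxE mcoeffB. Qed.
HB.instance Definition _ m :=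
  GRing.isAdditive.Build F R (mono_coeff m) (mono_coeff_is_additive m).

Lemma mono_coeffC m c f : mono_coeff m (c%:MP *: f) = c * mono_coeff m f.
Proof. by rewrite /mono_coeff mxE mcoeffCM. Qed.

Lemma mono_coeff_eq0 f : (forall m, mono_coeff m f = 0) -> f = 0.
Proof.
move=> f0; apply/rowP => i; apply/mpolyP => u.
by rewrite mxE mcoeff0; apply: (f0 (u, i)).
Qed.

Lemma mem_supp f m : (m \in supp f) = (mono_coeff m f != 0).
Proof.
rewrite -mcoeff_msupp; case: m => u i /=.
apply/allpairsPdep/idP => [[j [v [_ vf [-> ->]]]] //|uf].
by exists i, u; rewrite mem_enum.
Qed.

Definition bounded_by m f : Prop :=
  forall m', mono_coeff m' f != 0 -> m' = m \/ gt m m'.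

Lemma gt_asym m m' : gt m m' -> gt m' m -> False.
Proof. by case: gt_order => irr tr _ _ _ mm' /(tr _ _ _ mm'); rewrite irr. Qed.

Lemma lead_monP f m :
  lead_mon gt f = Some m <-> mono_coeff m f != 0 /\ bounded_by m f.
Proof.
rewrite /lead_mon; set P := fun _ => _; split.
  case E: [seq m <- _ | P m] => [//|m0 s] [em].
  have : m \in [seq m <- supp f | P m] by rewrite E em mem_head.
  rewrite mem_filter mem_supp => /andP[/allP Pm mf]; split=> // m'.
  by rewrite -mem_supp => /Pm/orP[/eqP|]; [left|right].
case=> mf bm.
have Pm : P m.
  by apply/allP => m'; rewrite mem_supp => /bm[->|->]; rewrite ?eqxx ?orbT.
have : m \in [seq m <- supp f | P m] by rewrite mem_filter Pm mem_supp.
case E: [seq m <- supp f | P m] => [//|m0 s] _ /=; congr Some.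
have : m0 \in [seq m <- supp f | P m] by rewrite E mem_head.
rewrite mem_filter mem_supp => /andP[/allP/(_ m)]; rewrite mem_supp => /(_ mf).
case/orP => [/eqP //|m0m] /bm[//|/gt_asym /(_ m0m) []].
Qed.

Lemma lead_mon_exists f : f != 0 -> exists m, lead_mon gt f = Some m.
Proof.
move=> f0; have : supp f != [::].
  apply: contra f0 => /eqP sf; apply/eqP/mono_coeff_eq0 => m.
  by apply/eqP; rewrite -[_ == _]negbK -mem_supp sf.
case/(seq_max gt_order id) => m; rewrite mem_supp => mf mmax.
by exists m; apply/lead_monP; split=> // m'; rewrite -mem_supp => /mmax.
Qed.

Lemma lcE f m : lead_mon gt f = Some m -> lc gt f = mono_coeff m f.
Proof. by rewrite /lc => ->. Qed.

Lemma bounded_by_lin m c f g : bounded_by m f -> bounded_by m g ->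
  bounded_by m (c%:MP *: f + g).
Proof.
move=> bf bg m'; rewrite raddfD /= mono_coeffC.
have [->|/bf //] := eqVneq (mono_coeff m' f) 0.
by rewrite mulr0 add0r => /bg.
Qed.

Definition mdvd (m m' : monom n r) : bool :=
  (m.1 <= m'.1)%MM && (m.2 == m'.2).

Lemma mdvdP m m' : mdvd m m' -> m' = mulm (m'.1 - m.1) m.
Proof.
by case/andP=> le /eqP e; rewrite /mulm submK // e -surjective_pairing.
Qed.

Lemma mono_coeff_mulm w m f :
  mono_coeff (mulm w m) ('X_[w] *: f) = mono_coeff m f.
Proof. by rewrite /mono_coeff mxE mulrC mcoeffMX. Qed.

Lemma bounded_by_mulm w m f :
  bounded_by m f -> bounded_by (mulm w m) ('X_[w] *: f).
Proof.
case: gt_order => _ _ _ _ gt_mul bf m'; rewrite /mono_coeff mxE -mcoeff_msupp.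
move=> /msuppM_le/allpairsP[[a b] [/=]]; rewrite msuppX inE => /eqP -> bf' e.
have -> : m' = mulm w (b, m'.2) by rewrite /mulm /= -e -surjective_pairing.
have [|->|/gt_mul gmb] := bf (b, m'.2); last by right.
  by rewrite /mono_coeff -mcoeff_msupp.
by left.
Qed.

Lemma mono_coeff_LT m (p : S) g :
  exists q, mono_coeff m (p *: LT gt g) = q * lc gt g /\
    (forall m', lead_mon gt g = Some m' -> ~~ mdvd m' m -> q = 0).
Proof.
rewrite /LT; case E: lead_mon => [m'|]; last first.
  by exists 0; split=> //; rewrite scaler0 raddf0 mul0r.
exists ((p * 'X_[m'.1])@_(m.1) *+ (m.2 == m'.2)); split=> [|_ [<-]].
  rewrite /mono_coeff !mxE eqxx /= mulr_natr mulrnAr mcoeffMn mulrnAl.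
  by rewrite -scalerAr mcoeffZ mulrC.
rewrite /mdvd negb_and eq_sym; case: eqP => [_|_ _]; last by rewrite mulr0n.
rewrite orbF mulr1n => ndvd; apply/memN_msupp_eq0/negP.
move=> /msuppM_le/allpairsP[[a b] [/= _]]; rewrite msuppX inE => /eqP -> e.
by rewrite e lem_addl in ndvd.
Qed.

Variables (U : submodClosed F) (G : seq F).
Hypothesis R_bezout : is_bezout R.
Hypothesis G_groebner : is_groebner gt U G.
Hypothesis G_lc : forall g, g \in G -> nonzerodivisor (lc gt g).

(** The elements [f] whose coefficient at [m] vanishes are included, which makes
    this an ideal without a case distinction. *)
Definition lc_ideal m : set R :=
  [set c | exists f, [/\ f \in U, bounded_by m f & mono_coeff m f = c]].

Definition lead_dvd m g : bool :=
  if lead_mon gt g is Some m' then mdvd m' m else false.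

Definition lead_monom m : bool := has (lead_dvd m) G.

Lemma lc_ideal_lc m g : g \in G -> lead_dvd m g -> lc_ideal m (lc gt g).
Proof.
rewrite /lead_dvd => gG; case E: lead_mon => [m'|//] dvd.
have [_ bg] := (lead_monP _ _).1 E; have gU := G_groebner.1 _ gG.
exists ('X_[m.1 - m'.1] *: g); split; first exact: rpredZ.
- by rewrite {1}(mdvdP dvd); apply: bounded_by_mulm.
- by rewrite {1}(mdvdP dvd) mono_coeff_mulm (lcE E).
Qed.

(** Where the Groebner basis property enters: the leading term of an element of
    [U] is a combination of leading terms of [G], and comparing coefficients
    at [m] only those dividing [m] remain. When there are none, taking [d] equal
    to 0 shows that the ideal is zero. *)
Lemma lc_ideal_gen m c d : (forall g, g \in G -> lead_dvd m g ->
    exists q, lc gt g = q * d) -> lc_ideal m c -> exists q, c = q * d.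
Proof.
move=> dG [f [fU bf <-]].
have [->|c0] := eqVneq (mono_coeff m f) 0; first by exists 0; rewrite mul0r.
have lead_f : lead_mon gt f = Some m by apply/lead_monP.
have f0 : f != 0 by apply: contraNneq c0 => ->; rewrite raddf0.
have : LTmod gt U (LT gt f).
  exists 1%N, (fun=> 1), (fun=> LT gt f); split=> [_|].
    by exists f.
  by rewrite big_ord1 scale1r.
rewrite -G_groebner.2 => -[k [p [x [xG /(congr1 (mono_coeff m))]]]].
have -> : mono_coeff m (LT gt f) = mono_coeff m f.
  rewrite /LT lead_f (lcE lead_f) /mono_coeff !mxE !eqxx mulr1 mcoeffZ.
  by rewrite mcoeffX eqxx mulr1.
move=> ->; rewrite raddf_sum /=.
elim/big_ind: _ => [|_ _ [a ->] [b ->]|j _]; first by exists 0; rewrite mul0r.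
  by exists (a + b); rewrite mulrDl.
have [g gG <-] := xG j; have [q [-> q0]] := mono_coeff_LT m (p j) g.
have [|ndvd] := boolP (lead_dvd m g).
  by move=> /(dG _ gG)[q' ->]; exists (q * q'); rewrite mulrA.
exists 0; rewrite mul0r; move: ndvd; rewrite /lead_dvd.
case E: lead_mon => [m'|]; first by move=> /(q0 _ E) ->; rewrite mul0r.
by rewrite /lc E mulr0.
Qed.

(** The gcd of the leading coefficients concerned divides a nonzerodivisor, so
    it is one itself. *)
Lemma lc_ideal_principal m : lead_monom m -> exists f,
  [/\ f \in U, bounded_by m f, nonzerodivisor (mono_coeff m f)
    & forall c, lc_ideal m c -> exists q, c = q * mono_coeff m f].
Proof.
case/hasP=> g0 g0G g0m.
have [||x|d [f [fU bf <-]] dG] := @bezout_gcd _ (lc_ideal m)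
  [seq lc gt g | g <- G & lead_dvd m g] R_bezout.
- exists 0; split; [exact: rpred0| |exact: raddf0].
  by move=> m'; rewrite raddf0 eqxx.
- move=> a _ _ [f [fU bf <-]] [g [gU bg <-]].
  exists (a%:MP *: f + g); split; first by rewrite rpredD ?rpredZ.
    exact: bounded_by_lin.
  by rewrite raddfD /= mono_coeffC.
- case/mapP=> g; rewrite mem_filter => /andP[gm gG] ->.
  exact: lc_ideal_lc.
have {}dG g : g \in G -> lead_dvd m g -> exists q, lc gt g = q * mono_coeff m f.
  by move=> gG gm; apply/dG/map_f; rewrite mem_filter gm.
exists f; split=> // [b fb0|c]; last exact: lc_ideal_gen.
have [q eq] := dG _ g0G g0m.
by apply: (G_lc g0G); rewrite eq -mulrA fb0 mulr0.
Qed.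

Definition lead_index : choiceType := {m : monom n r | lead_monom m}.

(* The family [u] is to realize the generators of the ideals of leading
   coefficients. *)
Variable u : lead_index -> F.
Hypothesis uU : forall m : lead_index, u m \in U.
Hypothesis u_bounded : forall m : lead_index, bounded_by (val m) (u m).
Hypothesis u_nzd :
  forall m : lead_index, nonzerodivisor (mono_coeff (val m) (u m)).
Hypothesis u_gen : forall (m : lead_index) c, lc_ideal (val m) c ->
  exists q, c = q * mono_coeff (val m) (u m).

(** The division algorithm: subtracting a multiple of [u] removes the leading
    monomial, and the order is well founded. *)
Lemma lead_family_span f : f \in U ->
  exists2 h, tail_le 0 0 h & lincomb u h = f.
Proof.
move=> fU; have [->|f0] := eqVneq f 0.
  by exists 0; [apply: tail_le0 | rewrite linear0].
have [m /lead_monP[_]] := lead_mon_exists f0.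
elim: (monomial_order_wf gt_order m) f fU f0 => {}m _ IH f fU _ bf.
have IH0 g : g \in U -> bounded_by m g -> mono_coeff m g = 0 ->
    exists2 h, tail_le 0 0 h & lincomb u h = g.
  move=> gU bg g0; have [->|g_neq0] := eqVneq g 0.
    by exists 0; [apply: tail_le0 | rewrite linear0].
  have [m' /lead_monP[gm' bg']] := lead_mon_exists g_neq0.
  apply: (IH m') => //; have [em|//] := bg _ gm'.
  by rewrite em g0 eqxx in gm'.
have fm : lc_ideal m (mono_coeff m f) by exists f.
have [lead_m|not_lead] := boolP (lead_monom m); last first.
  apply: IH0 => //.
  have [g gG gm|q ->] := @lc_ideal_gen m _ 0 _ fm; last by rewrite mulr0.
  by case/hasP: not_lead; exists g.
pose i : lead_index := exist _ m lead_m.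
have [q eq] := @u_gen i _ fm.
have [|||h h_tail eh] := IH0 ((- q)%:MP *: u i + f).
- by rewrite rpredD ?rpredZ.
- exact/bounded_by_lin/bf/u_bounded.
- by rewrite raddfD /= mono_coeffC mulNr -eq addNr.
exists (<< q%:MP *g i >> + h).
  apply: tail_leD => //; apply: tail_leU => w.
  rewrite msuppC; case: ifP => // _; rewrite inE => /eqP ->.
  by rewrite leqn0; apply/tail_deg_eq0P => j _; rewrite mnm0E.
by rewrite linearD /= lincombU eh mpolyCN scaleNr addNKr.
Qed.

(** At the largest monomial that occurs, only the member of the family with that
    leading monomial contributes, and its coefficient there is a
    nonzerodivisor. *)
Lemma lead_family_free h : tail_le 0 0 h -> lincomb u h = 0 -> h = 0.
Proof.
move=> h_tail h0; apply/eqP; apply: contraT => h_neq0; apply/negP => _.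
have [|m mh mmax] := @seq_max _ _ _ gt_order _ val (dom h).
  by rewrite dom_eq0.
have := congr1 (mono_coeff (val m)) h0.
rewrite raddf0 lincombE raddf_sum (bigD1_seq m) ?uniq_dom //= big_seq_cond.
rewrite big1 ?addr0 => [|i /andP[ih im]]; last first.
  rewrite (tail_le00_coeff _ h_tail) mono_coeffC.
  have [->|/u_bounded[/val_inj em|gi]] := eqVneq (mono_coeff (val m) (u i)) 0.
  - by rewrite mulr0.
  - by rewrite em eqxx in im.
  - case: (mmax _ ih) => [/val_inj em|gm]; first by rewrite em eqxx in im.
    by case: (gt_asym gi gm).
rewrite (tail_le00_coeff _ h_tail) mono_coeffC mulrC => /u_nzd c0.
by move: mh; rewrite mem_dom (tail_le00_coeff _ h_tail) c0 eqxx.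
Qed.

End GroebnerFree.

Lemma groebner_free_over_first0 (R : comNzRingType) n r (gt : rel (monom n r))
    (U : submodClosed 'rV[{mpoly R[n]}]_r) G :
    is_bezout R -> monomial_order gt -> is_groebner gt U G ->
    (forall g, g \in G -> nonzerodivisor (lc gt g)) ->
  free_over_first 0 (submodule U).
Proof.
move=> bezR gt_order G_gr G_lc.
have /choice[u uP] (m : lead_index gt G) :=
  lc_ideal_principal gt_order bezR G_gr G_lc (valP m).
have uU m : u m \in U by case: (uP m).
have u_bounded m : bounded_by gt (val m) (u m) by case: (uP m).
have u_nzd m : nonzerodivisor (mono_coeff (val m) (u m)) by case: (uP m).
have u_gen m c : lc_ideal gt U (val m) c ->
    exists q, c = q * mono_coeff (val m) (u m) by case: (uP m) => _ _ _; apply.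
pose e m : submodule U := Submodule (uU m).
have val_e h : val (lincomb e h) = lincomb u h.
  exact: (linear_lincomb (submodule_incl U)).
exists (lead_index gt G), e; split=> [v|h h_tail h0].
  have [h h_tail eh] :=
    lead_family_span gt_order G_gr uU u_bounded u_gen (valP v).
  by exists h => //; apply: val_inj; rewrite val_e.
apply: (lead_family_free gt_order u_bounded u_nzd h_tail).
by rewrite -[LHS]val_e h0.
Qed.

(** * The resolution *)

Section QuotientMap.
Variables (S : comNzRingType) (V : lmodType S) (U : submodClosed V).

Definition quot_map (x : V) : lmod_quot U := \pi_(lmod_quot U) x.

Lemma quot_mapP x y : quot_map x = quot_map y <-> x - y \in U.
Proof.
have e := Quotient.idealrBE (submod_pred U : zmodClosed V) x y.
split=> [h|h]; first by rewrite -[_ \in U]/(_ \in submod_pred U) e; apply/eqP.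
by apply/eqP; rewrite -e.
Qed.

Fact quot_map_is_linear : linear quot_map.
Proof.
move=> c x y; rewrite /quot_map.
rewrite [LHS](Quotient.pi_add (submod_pred U : zmodClosed V)).
congr (_ + _); apply/quot_mapP; rewrite -scalerBr; apply: rpredZ.
by apply/quot_mapP; rewrite /quot_map reprK.
Qed.

HB.instance Definition _ :=
  GRing.isLinear.Build S V (lmod_quot U) *:%R quot_map quot_map_is_linear.

End QuotientMap.

Theorem corollary6p9
    (A : Type) (hA : infinite_set [set: A])
    (D : A -> idomainType) (hD : forall i, is_pid (D i))
    (N : forall i, D i) (hN : forall i, N i \isn't a GRing.unit)
    (n : nat) (M : lmodType {mpoly (pid_product hA hN)[n]})
    (hM : finitely_generated [set: M])
    (r : nat) (U : submodClosed 'rV[{mpoly (pid_product hA hN)[n]}]_r)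
    (hMU : lmod_iso M (lmod_quot U))
    (hU : exists gt : rel (monom n r),
      [/\ monomial_order gt,
          finitely_generated (LTmod gt U)
        & exists G : seq 'rV[{mpoly (pid_product hA hN)[n]}]_r,
            is_groebner gt U G /\
            forall f, f \in G -> nonzerodivisor (lc gt f)]) :
  exists p : nat, (p <= n.+1)%N /\ free_resolution_of_length M p.
Proof.
exists n.+1; split=> //.
have [gt [gt_order _ [G [G_gr G_lc]]]] := hU.
have R_bezout : is_bezout (pid_product hA hN).
  by apply: prod_ring_bezout => i; apply: principal_quot_bezout.
have U_free := groebner_free_over_first0 R_bezout gt_order G_gr G_lc.
have U_res := free_over_first_resolution (add0n n) U_free.
have [f [f' fK f'K]] := hMU.
have f'_linear : linear f'.
  by move=> c x y; apply: (can_inj fK); rewrite linearP !f'K.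
pose f'L := GRing.isLinear.Build _ _ _ _ f' f'_linear.
pose g : {linear lmod_quot U -> M} := HB.pack f' f'L.
apply: (free_resolution_splice (q := (g \o @quot_map _ _ U)%FUN)
  (@submodule_incl_inj _ _ U) (is_free_rV _ r) _ _ U_res).
  apply/seteqP; split=> // x _; exists (repr (f x)) => //=.
  by rewrite /quot_map reprK fK.
rewrite /exact_at range_submodule_incl; apply/seteqP.
have quot0 x : quot_map U x = 0 <-> x \in U.
  by rewrite -[0](linear0 (@quot_map _ _ U)) quot_mapP subr0.
split=> x /= => [/quot0 ->|gx0]; first exact: (linear0 g).
by apply/quot0; rewrite -[LHS]f'K gx0 linear0.
Qed.
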